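(* Let $n\ge2$ and let $\mathcal{I}=\mathcal{I}^{\mathrm{perm}_n,2}\subset\mathrm{Sym}(V)=\mathbb{C}[x^i_j:1\le i,j\le n]$ be the ideal generated by all $2\times2$ sub-permanents $x^i_jx^k_l+x^i_lx^k_j$ of the $n\times n$ matrix $(x^i_j)$. Then the Hilbert polynomial of $\mathrm{Sym}(V)/\mathcal{I}$ is $$HP(t)=\sum_{i=0}^n f_i\binom{t-1}{i},$$ where $f_0=n^2$, $f_1=\binom{n^2}{2}-\binom n2^2$, $f_2=2\binom n2^2+2n\binom n3$, and $f_i=2n\binom{n}{i+1}$ for $3\le i\le n$. *)

(* Defs.v *)
From HB Require Import structures.
From mathcomp Require Import all_boot all_algebra ring_quotient.
From mathcomp Require Import boolp reals.
From mathcomp.real_closed Require Import complex.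
From mathcomp Require Import mpoly.

Set Implicit Arguments.
Unset Strict Implicit.
Unset Printing Implicit Defensive.

Import GRing.Theory.
Local Open Scope ring_scope.
Local Open Scope quotient_scope.

Definition ideal_gen (A : comNzRingType) (G : A -> Prop) (p : A) : Prop :=
  exists s : seq (A * A),
    (forall q, q \in s -> G q.2) /\ p = \sum_(q <- s) q.1 * q.2.

(* [mxvec_index] is the library's bijection from 'I_n x 'I_n to 'I_(n * n). *)
Definition xvar (K : fieldType) (n : nat) (i j : 'I_n) : {mpoly K[n * n]} :=
  'X_(mxvec_index i j).

Definition is_subperm2 (K : fieldType) (n : nat) (p : {mpoly K[n * n]}) : Prop :=
  exists i k j l : 'I_n,
    [/\ (i < k)%N, (j < l)%N &
        p = xvar K i j * xvar K k l + xvar K i l * xvar K k j].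

Definition perm2_ideal (K : fieldType) (n : nat) : {pred {mpoly K[n * n]}} :=
  fun p => `[< ideal_gen (@is_subperm2 K n) p >].

Lemma perm2_ideal_closed (K : fieldType) (n : nat) :
  idealr_closed (@perm2_ideal K n).
Proof.
split.
- by apply/asboolP; exists [::]; split => //; rewrite big_nil.
- apply/negP => /asboolP [s [sG /(congr1 (meval (fun=> 0)))]].
  rewrite meval1 raddf_sum big_seq big1; first by move/eqP; rewrite oner_eq0.
  move=> q /sG [i [k [j [l [_ _ e]]]]] /=.
  by rewrite mevalM e mevalD !mevalM !mevalXU !mulr0 addr0 mulr0.
- move=> a p q /asboolP [s [sG ->]] /asboolP [r [rG ->]]; apply/asboolP.
  exists ([seq (a * u.1, u.2) | u <- s] ++ r); split.
    move=> u; rewrite mem_cat => /orP [/mapP [v vs ->]|]; first exact: (sG v vs).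
    exact: rG.
  rewrite big_cat big_map mulr_sumr; congr (_ + _).
  by apply: eq_bigr => u _; rewrite mulrA.
Qed.

HB.instance Definition _ (K : fieldType) (n : nat) :=
  isIdealr.Build {mpoly K[n * n]} (@perm2_ideal K n) (@perm2_ideal_closed K n).

Definition mpoly_quot (K : fieldType) (N : nat) (I : idealr {mpoly K[N]}) : Type :=
  {ideal_quot I}.

Section MpolyQuot.
Variables (K : fieldType) (N : nat) (I : idealr {mpoly K[N]}).

HB.instance Definition _ := GRing.ComNzRing.on (mpoly_quot I).

Definition mpoly_pi (p : {mpoly K[N]}) : mpoly_quot I := \pi_{ideal_quot I} p.

Lemma mpoly_piD : {morph mpoly_pi : p q / p + q}.
Proof. by move=> p q; rewrite /mpoly_pi rmorphD. Qed.

Lemma mpoly_piM : {morph mpoly_pi : p q / p * q}.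
Proof. by move=> p q; rewrite /mpoly_pi rmorphM. Qed.

Lemma mpoly_pi1 : mpoly_pi 1 = 1.
Proof. by rewrite /mpoly_pi rmorph1. Qed.

Definition mpoly_quot_scale (c : K) (q : mpoly_quot I) : mpoly_quot I :=
  mpoly_pi c%:MP * q.

Lemma mpoly_quot_scaleA (a b : K) (q : mpoly_quot I) :
  mpoly_quot_scale a (mpoly_quot_scale b q) = mpoly_quot_scale (a * b) q.
Proof. by rewrite /mpoly_quot_scale mulrA -mpoly_piM mpolyCM. Qed.

Lemma mpoly_quot_scale1 : left_id 1 mpoly_quot_scale.
Proof. by move=> q; rewrite /mpoly_quot_scale mpolyC1 mpoly_pi1 mul1r. Qed.

Lemma mpoly_quot_scaleDr : right_distributive mpoly_quot_scale +%R.
Proof. by move=> a p q; rewrite /mpoly_quot_scale mulrDr. Qed.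

Lemma mpoly_quot_scaleDl (q : mpoly_quot I) :
  {morph mpoly_quot_scale^~ q : a b / a + b}.
Proof. by move=> a b; rewrite /mpoly_quot_scale mpolyCD mpoly_piD mulrDl. Qed.

HB.instance Definition _ := GRing.Zmodule_isLmodule.Build K (mpoly_quot I)
  mpoly_quot_scaleA mpoly_quot_scale1 mpoly_quot_scaleDr mpoly_quot_scaleDl.

Definition quot_graded (t : nat) (q : mpoly_quot I) : Prop :=
  exists2 p : {mpoly K[N]}, p \is t.-homog & q = mpoly_pi p.

End MpolyQuot.

Definition subspace_dim (K : fieldType) (V : lmodType K) (S : V -> Prop)
    (d : nat) : Prop :=
  exists b : 'I_d -> V,
    [/\ forall i, S (b i),
        forall c : 'I_d -> K, \sum_i c i *: b i = 0 -> forall i, c i = 0 &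
        forall v, S v -> exists c : 'I_d -> K, v = \sum_i c i *: b i].

(* A relation because dimensions are: [h] is the Hilbert function, hence unique,
   and [P] is unique since a polynomial is determined by its values at large t. *)
Definition is_hilbert_poly (K : fieldType) (N : nat) (I : idealr {mpoly K[N]})
    (P : {poly rat}) : Prop :=
  exists h : nat -> nat,
    (forall t, subspace_dim (@quot_graded K N I t) (h t)) /\
    exists t0, forall t, (t0 <= t)%N -> (h t)%:R = P.[t%:R].

(* The polynomial q (q - 1) ... (q - i + 1) / i!, so that [binom_poly ('X - 1) i]
   takes the value binomial(t - 1, i) at every t, without truncation. *)
Definition binom_poly (q : {poly rat}) (i : nat) : {poly rat} :=
  (i`!%:R)^-1 *: \prod_(k < i) (q - (k%:R)%:P).

(* Main.v *)
Require Import Defs.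
From HB Require Import structures.
From mathcomp Require Import all_boot all_algebra ring_quotient.
From mathcomp Require Import boolp reals.
From mathcomp.real_closed Require Import complex.
From mathcomp Require Import mpoly.
From mathcomp Require Import zify ring.
Import GRing.Theory.
Local Open Scope ring_scope.

Set Implicit Arguments.
Unset Strict Implicit.
Unset Printing Implicit Defensive.

(* Modulo the ideal, the monomial x_{w_1 v_1} ... x_{w_t v_t} attached to a pair
   of words only changes sign when w or v is permuted, so the quotient in degree
   t is spanned by the monomials of pairs of sorted words. These have distinct
   bidegrees, hence those that are nonzero form a basis. If two letters of w are
   equal, w has another letter and v has three letters, then three swaps give the
   monomial back with a minus sign, so it vanishes. For t > n the surviving pairs
   are those with w constant, v constant, or w and v both using exactly two
   letters; such monomials are nonzero at a point of the zero set of the ideal.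
   Counting them gives 2 n C(t+n-1,t) - n^2 + (C(n,2) (t-1))^2, which Vandermonde's
   identity expands in the basis C(t-1,i). *)

(** * Word products under the exchange relation *)

Section Words.
Variables (A : comNzRingType) (I J : eqType) (y : I -> J -> A).

(* [zip] truncates, so this is meaningful only for words of equal length. *)
Definition wordprod (w : seq I) (v : seq J) : A := \prod_(p <- zip w v) y p.1 p.2.

Lemma wordprod_cons i w j v :
  wordprod (i :: w) (j :: v) = y i j * wordprod w v.
Proof. by rewrite /wordprod /= big_cons. Qed.

Lemma wordprod_cat w1 w2 v1 v2 : size w1 = size v1 ->
  wordprod (w1 ++ w2) (v1 ++ v2) = wordprod w1 v1 * wordprod w2 v2.
Proof. by move=> e; rewrite /wordprod zip_cat // big_cat. Qed.

Hypothesis y_anticomm : forall i k j l, i != k -> j != l ->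
  y i j * y k l = - (y i l * y k j).

(** Induction on [w]. When the heads [j] and [j'] differ, the induction hypothesis rearranges the
    tail of [v] into that of [v'] with [j'] in place of one [j]; a single exchange of these two
    letters then finishes. *)
Lemma wordprod_perm_cols w v v' : perm_eq v v' -> size w = size v ->
  exists b : bool, wordprod w v = (-1) ^+ b * wordprod w v'.
Proof.
elim: w v v' => [|i w IHw] [|j v] v' //.
  by rewrite perm_sym => /perm_nilP -> _; exists false; rewrite expr0 mul1r.
move=> pvv' [szw].
case: v' pvv' => [|j' v']; first by move/perm_size.
have [<-|neq] := eqVneq j j'.
  rewrite perm_cons => /IHw /(_ szw) [b e]; exists b.
  by rewrite !wordprod_cons e mulrCA.
move=> pvv'; have jv' : j \in v'.
  have: j \in j' :: v' by rewrite -(perm_mem pvv') mem_head.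
  by rewrite inE (negPf neq).
case/splitPr: jv' pvv' => p1 p2 pvv'.
have pv : perm_eq v (p1 ++ j' :: p2).
  rewrite -(perm_cons j); apply: (perm_trans pvv').
  rewrite -cat_cons (perm_catCA (j' :: p1) [:: j]) perm_cons perm_sym.
  exact/permPl/(perm_catCA p1 [:: j']).
have [b e] := IHw _ _ pv szw.
have szp : (size p1 < size w)%N.
  by rewrite szw (perm_size pv) size_cat /= addnS ltnS leq_addr.
rewrite wordprod_cons e.
set q1 := take (size p1) w; set d := nth i w (size p1).
set q2 := drop (size p1).+1 w.
have wE : w = q1 ++ d :: q2 by rewrite -drop_nth // cat_take_drop.
have sq : size q1 = size p1 by rewrite size_takel // ltnW.
have [b' e'] : exists b' : bool, wordprod (i :: w) (j :: p1 ++ j' :: p2) =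
    (-1) ^+ b' * wordprod (i :: w) (j' :: p1 ++ j :: p2).
  (* The exchange costs a sign only between different rows [i] and [d]; within one row it is
     commutativity. *)
  exists (i != d); rewrite wE !wordprod_cons !wordprod_cat // !wordprod_cons.
  have -> : y i j * (wordprod q1 p1 * (y d j' * wordprod q2 p2)) =
            (y i j * y d j') * (wordprod q1 p1 * wordprod q2 p2) by ring.
  have -> : y i j' * (wordprod q1 p1 * (y d j * wordprod q2 p2)) =
            (y i j' * y d j) * (wordprod q1 p1 * wordprod q2 p2) by ring.
  case: eqVneq => [<-|neqd] /=; first by rewrite expr0 mul1r; ring.
  by rewrite expr1 y_anticomm //; ring.
exists (b (+) b'); rewrite signr_addb -mulrA -e' wordprod_cons; ring.
Qed.
End Words.

Section PermWords.
Variables (A : comNzRingType) (I J : eqType) (y : I -> J -> A).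
Hypothesis y_anticomm : forall i k j l, i != k -> j != l ->
  y i j * y k l = - (y i l * y k j).

(** Carries statements about columns over to rows, since the exchange relation is itself symmetric
    under transposition. *)
Lemma wordprod_transpose w v : wordprod y w v = wordprod (fun j i => y i j) v w.
Proof.
rewrite /wordprod; elim: w v => [|i w IHw] [|j v] /=; rewrite ?big_nil //.
by rewrite !big_cons IHw.
Qed.

Lemma transpose_anticomm j l i k : j != l -> i != k ->
  y i j * y k l = - (y k j * y i l).
Proof. by move=> jl ik; rewrite y_anticomm // mulrC. Qed.

Lemma wordprod_perm w w' v v' : perm_eq w w' -> perm_eq v v' ->
  size w = size v ->
  exists b : bool, wordprod y w v = (-1) ^+ b * wordprod y w' v'.
Proof.
move=> pw pv sz; have [b ->] := wordprod_perm_cols y_anticomm pv sz.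
rewrite wordprod_transpose.
have sz' : size v' = size w by rewrite sz (perm_size pv).
have [b' ->] := wordprod_perm_cols transpose_anticomm pw sz'.
by exists (b (+) b'); rewrite signr_addb mulrA -wordprod_transpose.
Qed.

(** Along the three swaps the column met by row [k] runs through [m], [l], [j] and back to [m]. The
    product equals its opposite, and 2 can be cancelled. *)
Lemma triangle_eq0 i k j l m : GRing.lreg (2%:R : A) ->
  i != k -> j != l -> j != m -> l != m -> y i j * y i l * y k m = 0.
Proof.
move=> reg2 ik jl jm lm.
have e : y i j * y i l * y k m = - (y i j * y i l * y k m).
  rewrite -[LHS]mulrA (y_anticomm ik lm) mulrN mulrCA (y_anticomm ik jl) mulrN.
  by rewrite opprK mulrCA (y_anticomm ik) 1?eq_sym // mulrN mulrCA mulrA.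
by apply: reg2; rewrite mulr0 mulr_natl mulr2n {1}e addNr.
Qed.

Lemma wordprod_eq0 w v : GRing.lreg (2%:R : A) -> size w = size v ->
    ~~ uniq w -> (1 < size (undup w))%N -> (2 < size (undup v))%N ->
  wordprod y w v = 0.
Proof.
move=> reg2 sz nuw w2 v3.
have [i wi] : exists i, (1 < count_mem i w)%N.
  apply: contrapT => nex; case/negP: nuw; apply: count_mem_uniq => i.
  have: (count_mem i w <= 1)%N.
    by rewrite leqNgt; apply/negP => lt; apply: nex; exists i.
  by rewrite -has_pred1 has_count; case: (count_mem i w) => [|[|]].
have [k kw ik] : exists2 k, k \in w & i != k.
  case uw: (undup w) w2 (undup_uniq w) => [|a [|b u]] //= _.
  have aw : a \in w by rewrite -mem_undup uw mem_head.
  have bw : b \in w by rewrite -mem_undup uw !inE eqxx orbT.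
  rewrite inE negb_or => /andP[/andP[ab _] _].
  by have [ia|] := eqVneq i a; [exists b; rewrite // ia | exists a].
have [w' pw] : exists w', perm_eq w [:: i, i, k & w'].
  have iw : i \in w by rewrite -has_pred1 has_count ltnW.
  have pw := perm_to_rem iw; have iw' : i \in rem i w.
    by move: wi; rewrite -has_pred1 has_count (permP pw) /= eqxx.
  have pw' := perm_to_rem iw'.
  have kw' : k \in rem i (rem i w).
    move: kw; rewrite (perm_mem pw) inE eq_sym (negPf ik) /=.
    by rewrite (perm_mem pw') inE eq_sym (negPf ik).
  exists (rem k (rem i (rem i w))).
  apply: (perm_trans pw); rewrite perm_cons; apply: (perm_trans pw').
  by rewrite perm_cons perm_to_rem.
(* The distinct letters of [v] form a subsequence, so they can be moved to the front. *)
have [v' pv] := perm_to_subseq (undup_subseq v).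
case uv: (undup v) pv v3 (undup_uniq v) => [|j [|l [|m u]]] //= pv _.
rewrite !inE !negb_or => /andP[/and3P[jl jm _] /andP[/andP[lm _] _]].
have [b ->] := wordprod_perm pw pv sz.
by rewrite !wordprod_cons (mulrA (y i l)) !(mulrA (y i j)) triangle_eq0 // mul0r mulr0.
Qed.
End PermWords.

(** * From polynomials to the quotient by the sub-permanents *)

Lemma rmorph_wordprod (A B : comNzRingType) (I J : eqType) (y : I -> J -> A)
    (g : {rmorphism A -> B}) w v :
  g (wordprod y w v) = wordprod (fun i j => g (y i j)) w v.
Proof. by rewrite /wordprod rmorph_prod. Qed.

Lemma mpolyX_s2m (R : comNzRingType) N (s : seq 'I_N) :
  'X_[s2m s] = \prod_(k <- s) 'X_k :> {mpoly R[N]}.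
Proof.
elim: s => [|k s IHs].
  by rewrite big_nil -mpolyX0; congr mpolyX.
rewrite big_cons -IHs -mpolyXD; congr mpolyX.
by apply/mnmP => i; rewrite mnmDE mnm1E !mnmE.
Qed.

Section MpolyPi.
Variables (K : fieldType) (N : nat) (I : idealr {mpoly K[N]}).

Lemma mpoly_pi_is_zmod_morphism : zmod_morphism (@mpoly_pi K N I).
Proof. by move=> p q; rewrite /mpoly_pi rmorphB. Qed.
Lemma mpoly_pi_is_monoid_morphism : monoid_morphism (@mpoly_pi K N I).
Proof. by split; [exact: mpoly_pi1 | exact: mpoly_piM]. Qed.
HB.instance Definition _ := GRing.isZmodMorphism.Build _ _ (@mpoly_pi K N I)
  mpoly_pi_is_zmod_morphism.
HB.instance Definition _ := GRing.isMonoidMorphism.Build _ _ (@mpoly_pi K N I)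
  mpoly_pi_is_monoid_morphism.

Lemma mpoly_pi_eq0 p : (mpoly_pi I p == 0) = (p \in I).
Proof.
by rewrite -[p in RHS]subr0 Quotient.idealrBE -(raddf0 (@mpoly_pi K N I)).
Qed.

Lemma mpoly_quot_scaleE c (q : mpoly_quot I) : c *: q = mpoly_pi I c%:MP * q.
Proof. by []. Qed.

Lemma mpoly_piZ c p : mpoly_pi I (c *: p) = c *: mpoly_pi I p.
Proof. by rewrite mpoly_quot_scaleE -rmorphM mul_mpolyC. Qed.

Lemma mpoly_quot_lreg c : c != 0 -> GRing.lreg (mpoly_pi I c%:MP).
Proof.
move=> c0 p q; rewrite -!mpoly_quot_scaleE => /(congr1 ( *:%R c^-1)).
by rewrite !scalerA mulVf // !scale1r.
Qed.
End MpolyPi.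

Section PermQuotient.
Variables (K : fieldType) (n : nat).
Local Notation Q := (mpoly_quot (@perm2_ideal K n)).
Local Notation pi := (mpoly_pi (@perm2_ideal K n)).
Local Notation x := (@xvar K n).

Definition xbar (i j : 'I_n) : Q := pi (x i j).

Lemma perm2_ideal_anticomm i k j l : i != k -> j != l ->
  xbar i j * xbar k l = - (xbar i l * xbar k j).
Proof.
(* Generators have increasing indices; the other orders follow by exchanging the two factors or
   reading the relation backwards. *)
suff gen (i' k' j' l' : 'I_n) : (i' < k')%N -> (j' < l')%N ->
    xbar i' j' * xbar k' l' = - (xbar i' l' * xbar k' j').
  rewrite !neq_ltn => /orP[ik|ki] /orP[jl|lj].
  - exact: gen.
  - by rewrite (gen _ _ l j) ?opprK.
  - by rewrite mulrC [X in - X]mulrC (gen _ _ j l) ?opprK.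
  - by rewrite mulrC [X in - X]mulrC gen.
move=> ik jl; apply/eqP; rewrite -addr_eq0 -!rmorphM -rmorphD mpoly_pi_eq0.
apply/asboolP; exists [:: (1, x i' j' * x k' l' + x i' l' * x k' j')].
split; last by rewrite big_seq1 mul1r.
by move=> q; rewrite inE => /eqP -> /=; exists i', k', j', l'.
Qed.

(** Shared by evaluation at points, which proves nonvanishing, and by the torus coaction, which
    proves independence. *)
Lemma perm2_ideal_ker (B : comNzRingType) (g : {rmorphism {mpoly K[n * n]} -> B}) p :
    (forall i k j l, i != k -> j != l ->
      g (x i j) * g (x k l) = - (g (x i l) * g (x k j))) ->
  p \in @perm2_ideal K n -> g p = 0.
Proof.
move=> anti /asboolP[s [sG ->]]; rewrite rmorph_sum big_seq big1 // => q /sG.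
move=> [i [k [j [l [ik jl ->]]]]]; rewrite rmorphM rmorphD !rmorphM /=.
rewrite anti; last 2 first.
- by rewrite -val_eqE ltn_eqF.
- by rewrite -val_eqE ltn_eqF.
by rewrite addNr mulr0.
Qed.

Lemma pi_wordprod w v : pi (wordprod x w v) = wordprod xbar w v.
Proof. exact: rmorph_wordprod. Qed.

End PermQuotient.

(** * The bigrading by rows and columns *)

Definition bidegree n (w v : seq 'I_n) : 'X_{1..n + n} :=
  s2m (map (@lshift n n) w ++ map (@rshift n n) v).

Section TorusCoaction.
Variables (K : fieldType) (Q : comNzRingType) (f : {rmorphism K -> Q}).
Variables (n : nat) (y : 'I_n -> 'I_n -> Q).
Local Notation x := (@xvar K n).

(* When [y i j] is the class of [x i j], this is the coaction of the torus scaling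
   rows and columns, which separates the bidegrees. *)
Definition torus_coaction : {mpoly K[n * n]} -> {mpoly Q[n + n]} :=
  mmap (@mpolyC (n + n) Q \o f) (fun k => mxvec (\matrix_(i, j)
       (y i j *: ('X_(lshift n i) * 'X_(rshift n j)))) 0 k).
HB.instance Definition _ := GRing.RMorphism.on torus_coaction.

Lemma torus_coaction_xvar i j :
  torus_coaction (x i j) = y i j *: ('X_(lshift n i) * 'X_(rshift n j)).
Proof. by rewrite /torus_coaction /xvar mmapX mmap1U mxvecE mxE. Qed.

Lemma torus_coactionZ c p : torus_coaction (c *: p) = f c *: torus_coaction p.
Proof. by rewrite /torus_coaction mmapZ mul_mpolyC. Qed.

Hypothesis y_anticomm : forall i k j l, i != k -> j != l ->
  y i j * y k l = - (y i l * y k j).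

(** Exchanging two columns leaves the product of the torus variables unchanged, so the images of the
    variables inherit the relation of [y]. *)
Lemma torus_coaction_ideal p : p \in @perm2_ideal K n -> torus_coaction p = 0.
Proof.
suff anti i k j l : i != k -> j != l ->
    torus_coaction (x i j) * torus_coaction (x k l) =
    - (torus_coaction (x i l) * torus_coaction (x k j)).
  exact: (@perm2_ideal_ker _ _ _ torus_coaction).
move=> ik jl; rewrite !torus_coaction_xvar -!scalerAl -!scalerAr !scalerA.
by rewrite (y_anticomm ik jl) scaleNr; congr (- (_ *: _)); ring.
Qed.

Lemma torus_coaction_wordprod w v : size w = size v ->
  torus_coaction (wordprod x w v) = wordprod y w v *: 'X_[bidegree w v].
Proof.
move=> sz; rewrite mpolyX_s2m big_cat !big_map /=.
elim: w v sz => [|i w IHw] [|j v] // => [_|[sz]].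
  by rewrite /wordprod !big_nil rmorph1 mulr1 scale1r.
have coactM p q : torus_coaction (p * q) = torus_coaction p * torus_coaction q.
  exact: rmorphM.
rewrite !wordprod_cons coactM IHw // torus_coaction_xvar !big_cons.
by rewrite -!scalerAl -!scalerAr !scalerA; congr (_ *: _); ring.
Qed.

End TorusCoaction.

(** * A basis of each graded piece *)

Section WordBasis.
Variables (K : fieldType) (n : nat).
Local Notation pi := (mpoly_pi (@perm2_ideal K n)).
Local Notation x := (@xvar K n).
Local Notation xbar := (@xbar K n).

Lemma bidegree_lshift (w v : seq 'I_n) i :
  bidegree w v (lshift n i) = count_mem i w.
Proof.
rewrite mnmE count_cat !count_map [X in (_ + X)%N](eq_count (a2 := pred0)).
  by rewrite count_pred0 addn0; apply: eq_count => k /=; rewrite eq_lshift.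
by move=> k /=; rewrite eq_rlshift.
Qed.

Lemma bidegree_rshift (w v : seq 'I_n) i :
  bidegree w v (rshift n i) = count_mem i v.
Proof.
rewrite mnmE count_cat !count_map [X in (X + _)%N](eq_count (a2 := pred0)).
  by rewrite count_pred0 add0n; apply: eq_count => k /=; rewrite eq_rshift.
by move=> k /=; rewrite eq_lrshift.
Qed.

(** A sorted word is determined by the multiplicities of its letters, which the bidegree records. *)
Lemma bidegree_inj t : {in setX (basis n t) (basis n t) &,
  injective (fun p : t.-tuple 'I_n * t.-tuple 'I_n => bidegree p.1 p.2)}.
Proof.
move=> [w v] [w' v']; rewrite !in_setX /= => /andP[bw bv] /andP[bw' bv'] /mnmP e.
congr (_, _); apply: (inj_s2m (n := n)) => //=; apply/mnmP => i; rewrite !mnmE.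
  by rewrite -!(bidegree_lshift _ v) e !bidegree_lshift.
by rewrite -!(bidegree_rshift w) e !bidegree_rshift.
Qed.

(** [basis n t] consists of the sorted words of length [t]. With nonvanishing built in, the family
    is a basis in every degree; which pairs qualify is decided later, for large [t] only. *)
Definition word_basis t : {set t.-tuple 'I_n * t.-tuple 'I_n} :=
  [set p in setX (basis n t) (basis n t) | wordprod xbar p.1 p.2 != 0].

Lemma mpolyX_wordprod (m : 'X_{1..n * n}) :
  exists w v, [/\ size w = mdeg m, size v = mdeg m & 'X_[m] = wordprod x w v].
Proof.
pose ij (k : 'I_(n * n)) := pair_of_mxvec_index (mxvec_indexP k).
exists [seq (ij k).1 | k <- m2s m], [seq (ij k).2 | k <- m2s m].
rewrite !size_map size_m2s; split=> //.
rewrite -[in LHS](s2mK m) mpolyX_s2m; elim: (m2s m) => [|k s IHs] /=.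
  by rewrite /wordprod !big_nil.
rewrite big_cons wordprod_cons IHs; congr (_ * _).
by rewrite /ij; case: (mxvec_indexP k).
Qed.

Lemma dhomog_wordprod w v : size w = size v ->
  wordprod x w v \is (size w).-homog.
Proof.
elim: w v => [|i w IHw] [|j v] //= => [_|[sz]].
  by rewrite /wordprod big_nil dhomog1.
rewrite wordprod_cons -add1n dhomogM ?IHw //.
by rewrite dhomogX /= mdeg1.
Qed.

Lemma sorted_word t (w : seq 'I_n) : size w = t ->
  exists2 w' : t.-tuple 'I_n, w' \in basis n t & perm_eq w w'.
Proof.
move=> sz; pose s := sort (fun i j : 'I_n => (i <= j)%N) w.
have szs : size s == t by rewrite size_sort sz.
exists (Tuple szs) => /=; last by rewrite perm_sym perm_sort.
rewrite inE sorted_map; apply: sort_sorted => i j; exact: leq_total.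
Qed.

Lemma quot_graded_dim t :
  subspace_dim (@quot_graded K (n * n) (@perm2_ideal K n) t) #|word_basis t|.
Proof.
pose b (i : 'I_#|word_basis t|) := enum_val i.
have bS i : b i \in setX (basis n t) (basis n t).
  by have := enum_valP i; rewrite inE => /andP[].
exists (fun i => wordprod xbar (b i).1 (b i).2); split.
- move=> i; exists (wordprod x (b i).1 (b i).2); last by rewrite pi_wordprod.
  rewrite -[t in t.-homog](size_tuple (b i).1).
  by apply: dhomog_wordprod; rewrite !size_tuple.
- move=> c; under eq_bigr do rewrite -pi_wordprod -mpoly_piZ.
  rewrite -(raddf_sum (@mpoly_pi K _ (@perm2_ideal K n))) => /eqP.
  rewrite mpoly_pi_eq0 => pI.
  (* Independence: a vanishing combination lifts to the ideal, and its coaction, taken with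
     [y := xbar], has as coefficient at the [i]-th bidegree [c i] times the [i]-th class. *)
  have e := torus_coaction_ideal (pi \o @mpolyC (n * n) K) (@perm2_ideal_anticomm K n) pI.
  move: e; rewrite raddf_sum /= => e i.
  have := congr1 (mcoeff (bidegree (b i).1 (b i).2)) e.
  rewrite mcoeff0 raddf_sum (bigD1 i) //= big1 => [|j ji].
    rewrite torus_coactionZ torus_coaction_wordprod ?size_tuple // !mcoeffZ.
    rewrite mcoeffX eqxx mulr1 addr0 => e'; apply: contraTeq (enum_valP i).
    move=> ci; rewrite inE negb_and negbK; apply/orP; right; apply/eqP.
    by apply: (mpoly_quot_lreg ci); rewrite e' mulr0.
  rewrite torus_coactionZ torus_coaction_wordprod ?size_tuple // !mcoeffZ.
  rewrite mcoeffX; case: eqP => [ij|_]; last by rewrite !mulr0.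
  case/eqP: ji.
  exact/enum_val_inj/(bidegree_inj (bS j) (bS i) ij).
move=> _ [p hp ->]; pose S v := exists c : 'I_#|word_basis t| -> K,
  v = \sum_i c i *: wordprod xbar (b i).1 (b i).2.
(* Spanning: a homogeneous lift involves only monomials of degree [t]. *)
suff SX m : mdeg m = t -> S (pi 'X_[m]).
  rewrite [p]mpolyE raddf_sum big_seq /=; apply: (big_ind S).
  - by exists (fun=> 0); rewrite big1 // => i _; rewrite scale0r.
  - move=> _ _ [c ->] [d ->]; exists (fun i => c i + d i).
    by rewrite -big_split; apply: eq_bigr => i _; rewrite scalerDl.
  - move=> m /(dhomog_mf hp) /SX [c e]; exists (fun i => p@_m * c i).
    by rewrite mpoly_piZ e scaler_sumr; apply: eq_bigr => i _; rewrite scalerA.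
move=> mt; have [w [v [szw szv ->]]] := mpolyX_wordprod m.
rewrite pi_wordprod; rewrite mt in szw szv.
have [w' bw ww'] := sorted_word szw; have [v' bv vv'] := sorted_word szv.
have [|e ->] := wordprod_perm (@perm2_ideal_anticomm K n) ww' vv'.
  by rewrite szw.
(* A pair outside [word_basis] has class zero, hence the zero combination. *)
have [z|nz] := eqVneq (wordprod xbar w' v') 0.
  by rewrite z mulr0; exists (fun=> 0); rewrite big1 // => i _; rewrite scale0r.
have wvb : (w', v') \in word_basis t by rewrite inE in_setX bw bv nz.
exists (fun i => if i == enum_rank_in wvb (w', v') then (-1) ^+ e else 0).
rewrite (bigD1 (enum_rank_in wvb (w', v'))) //= eqxx big1 => [|i /negPf ->].
  rewrite addr0 /b enum_rankK_in //= mpoly_quot_scaleE.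
  by rewrite !rmorph_sign.
by rewrite scale0r.
Qed.
End WordBasis.

(** * Nonvanishing word products in large degree *)

Lemma undup1P (T : eqType) (w : seq T) :
  reflect (exists i, w =i [:: i]) (size (undup w) == 1)%N.
Proof.
apply: (iffP eqP) => [|[i wi]].
  by case e: (undup w) => [|i [|]] // _; exists i => k; rewrite -mem_undup e.
rewrite (perm_size (s2 := [:: i])) //.
by apply: uniq_perm => // [|k]; rewrite ?undup_uniq // mem_undup wi.
Qed.

Lemma undup2P n (w : seq 'I_n) :
  reflect (exists i j : 'I_n, (i < j)%N /\ w =i [:: i; j]) (size (undup w) == 2)%N.
Proof.
apply: (iffP eqP) => [|[i [j [ij wij]]]].
  case e: (undup w) (undup_uniq w) => [|i [|j [|]]] // uij _.
  have wij k : (k \in w) = (k \in [:: i; j]) by rewrite -mem_undup e.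
  have: i != j by move: uij; rewrite /= inE andbT.
  rewrite -val_eqE neq_ltn => /orP[ij|ji]; first by exists i, j.
  by exists j, i; split=> // k; rewrite wij !inE orbC.
rewrite (perm_size (s2 := [:: i; j])) //.
apply: uniq_perm => [||k]; rewrite ?undup_uniq // ?mem_undup ?wij //=.
by rewrite inE andbT -val_eqE ltn_eqF.
Qed.

Section Eval.
Variables (K : fieldType) (n : nat).
Local Notation xbar := (@xbar K n).

(** [M] is a point of the zero set of the ideal at which the monomial takes a nonzero value. *)
Lemma wordprod_xbar_neq0 (M : 'M[K]_n) w v :
    (forall i k j l, i != k -> j != l -> M i j * M k l = - (M i l * M k j)) ->
    (forall i j, i \in w -> j \in v -> M i j != 0) ->
  wordprod xbar w v != 0.
Proof.
move=> anti nz; apply/negP; rewrite -pi_wordprod mpoly_pi_eq0.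
pose g := meval (fun k => mxvec M 0 k).
have gx i j : g (xvar K i j) = M i j by rewrite /g mevalXU mxvecE.
have ker p : p \in @perm2_ideal K n -> g p = 0.
  apply: (@perm2_ideal_ker _ _ _ g) => i k j l ik jl.
  by rewrite [LHS](congr2 *%R (gx i j) (gx k l)) anti // -!gx.
have gW : g (wordprod (@xvar K n) w v) = wordprod M w v.
  by rewrite /g rmorph_wordprod; apply: eq_bigr => p _; exact: gx.
move/ker; rewrite gW {gW}.
apply/eqP; elim: w v nz => [|i w IHw] [|j v] nz;
  rewrite ?/wordprod /= ?big_nil ?oner_eq0 //.
rewrite big_cons mulf_neq0 ?nz ?mem_head //.
by apply: IHw => k l kw lv; rewrite nz // inE ?kw ?lv orbT.
Qed.

Lemma wordprod_xbar_large w v : (2%:R : K) != 0 -> size w = size v ->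
    (n < size w)%N ->
  (wordprod xbar w v != 0) =
  [|| size (undup w) == 1, size (undup v) == 1 |
      (size (undup w) == 2) && (size (undup v) == 2)]%N.
Proof.
move=> K2 sz nw.
have undup_gt0 (u : seq 'I_n) : (n < size u)%N -> (0 < size (undup u))%N.
  by case: u => // i u _; have := mem_head i u; rewrite -mem_undup; case: undup.
have nuniq (u : seq 'I_n) : (n < size u)%N -> ~~ uniq u.
  move=> nu; apply/negP => /card_uniqP e.
  by move: nu; rewrite -e ltnNge -[X in (_ <= X)%N]card_ord max_card.
apply/idP/or3P => [|[/undup1P[i wi]|/undup1P[j vj]|/andP[]]].
- have reg2 : GRing.lreg (2%:R : mpoly_quot (@perm2_ideal K n)).
    rewrite -(rmorph_nat (@mpoly_pi K _ (@perm2_ideal K n))).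
    rewrite -(rmorph_nat (@mpolyC (n * n) K)).
    exact: mpoly_quot_lreg.
  have nv : (n < size v)%N by rewrite -sz.
  (* Otherwise both words have at least two letters and one of them has three. Both repeat a letter,
     being longer than [n], so the vanishing lemma applies, transposed if necessary. *)
  move=> nz; apply/or3P; apply: contraNT nz => d12; apply/eqP.
  have w2 : (1 < size (undup w))%N by have := undup_gt0 w nw; move: d12; lia.
  have v2 : (1 < size (undup v))%N by have := undup_gt0 v nv; move: d12; lia.
  have [v3|] := ltnP 2 (size (undup v)).
    exact: (wordprod_eq0 (@perm2_ideal_anticomm K n) reg2 sz (nuniq w nw)).
  move=> v3; rewrite wordprod_transpose.
  apply: (wordprod_eq0 (transpose_anticomm (@perm2_ideal_anticomm K n)) reg2) => //.
    exact: nuniq.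
  by move: d12; lia.
(* The point has ones along row [i] and zeros elsewhere, so a product of entries from two rows
   vanishes. *)
- apply: (@wordprod_xbar_neq0 (\matrix_(a, _) (a == i)%:R)).
    move=> a c b d ac bd; rewrite !mxE; case: (a =P i) ac => [->|_] ac.
      by rewrite eq_sym (negPf ac) !mulr0 oppr0.
    by rewrite !mul0r oppr0.
  by move=> a b; rewrite wi inE mxE => /eqP -> _; rewrite eqxx oner_eq0.
- apply: (@wordprod_xbar_neq0 (\matrix_(_, b) (b == j)%:R)).
    move=> a c b d ac bd; rewrite !mxE; case: (b =P j) bd => [->|_] bd.
      by rewrite eq_sym (negPf bd) mulr0 mul0r oppr0.
    by rewrite mul0r mulr0 oppr0.
  by move=> a b; rewrite vj inE mxE => _ /eqP ->; rewrite eqxx oner_eq0.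
move=> /undup2P[i [k [ik wik]]] /undup2P[j [l [jl vjl]]].
(* A 2 by 2 block with entries 1, 1, 1, -1 has permanent zero; any other sub-permanent meets a zero
   row or column. *)
pose M := \matrix_(a, b) (if (a \in [:: i; k]) && (b \in [:: j; l])
  then (-1) ^+ ((a == k) && (b == l)) else 0) : 'M[K]_n.
apply: (@wordprod_xbar_neq0 M) => [|a b]; last first.
  by rewrite wik vjl mxE => -> ->; rewrite signr_eq0.
have ki : (k == i) = false by rewrite -val_eqE gtn_eqF.
have lj : (l == j) = false by rewrite -val_eqE gtn_eqF.
(* These two facts discard the impossible cases of the Boolean analysis below: distinct indices do
   not equal the same letter, nor one index two letters. *)
have excl (T : eqType) (a c e : T) : a != c -> ~~ ((a == e) && (c == e)).
  by apply: contra => /andP[/eqP -> /eqP ->].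
have excl' (T : eqType) (a e f : T) : (f == e) = false -> ~~ ((a == e) && (a == f)).
  by move=> fe; apply: contraFN fe => /andP[/eqP <- /eqP <-].
move=> a c b d ac bd; rewrite !mxE !inE.
have := excl _ a c i ac; have := excl _ a c k ac.
have := excl _ b d j bd; have := excl _ b d l bd.
have := excl' _ a _ _ ki; have := excl' _ c _ _ ki.
have := excl' _ b _ _ lj; have := excl' _ d _ _ lj.
case: (a == i); case: (a == k); case: (c == i); case: (c == k) => //=;
  case: (b == j); case: (b == l); case: (d == j); case: (d == l) => //= *; ring.
Qed.
End Eval.

(** * Counting the surviving pairs *)

Section Count.
Local Open Scope nat_scope.
Variable n : nat.

Definition words_on t d : {set t.-tuple 'I_n} :=
  [set w in basis n t | size (undup w) == d].

Lemma card_words_on1 t : #|words_on t.+1 1| = n.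
Proof.
have -> : words_on t.+1 1 = [set nseq_tuple t.+1 i | i in 'I_n].
  apply/setP => w; rewrite inE; apply/andP/imsetP => [[_ /undup1P[i wi]]|[i _ ->]].
    exists i => //; apply/val_inj => /=.
    have /all_pred1P -> : all (pred1 i) w by apply/allP => k; rewrite wi inE.
    by rewrite size_tuple.
  split; last by apply/undup1P; exists i => k; rewrite mem_nseq inE.
  by rewrite inE map_nseq /=; elim: {w}t => //= t ->; rewrite leqnn.
rewrite card_in_imset ?card_ord // => i j _ _ /(congr1 (@thead _ _)).
by rewrite /thead !tnth_nseq.
Qed.

Lemma size_two_block (T : eqType) t (s : 'I_t) (i j : T) :
  size (nseq s.+1 i ++ nseq (t - s) j) == t.+1.
Proof. by rewrite size_cat !size_nseq addSn subnKC // ltnW. Qed.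

(** As [s < t], the blocks of lengths [s.+1] and [t - s] are nonempty: [s] runs over the [t] ways to
    cut a word of length [t.+1]. *)
Definition two_block t (p : 'I_n * 'I_n * 'I_t) : t.+1.-tuple 'I_n :=
  Tuple (size_two_block p.2 p.1.1 p.1.2).

Lemma two_block_mem t (p : 'I_n * 'I_n * 'I_t) :
  two_block p =i [:: p.1.1; p.1.2].
Proof.
case: p => [[i j] s] k; rewrite -[LHS]/(k \in nseq s.+1 i ++ nseq (t - s) j).
by rewrite mem_cat !mem_nseq subn_gt0 ltn_ord !inE.
Qed.

Lemma two_block_sorted t (i j : 'I_n) (s : 'I_t) : i < j ->
  two_block (i, j, s) \in basis n t.+1.
Proof.
move=> ij; rewrite inE /= map_cat !map_nseq cat_path.
apply/andP; split; first by elim: (nat_of_ord s) => //= k ->; rewrite leqnn.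
have -> : last (val i) (nseq s (val i)) = val i by elim: (nat_of_ord s).
have pj b : path leq (val j) (nseq b (val j)) by elim: b => //= b ->; rewrite leqnn.
by case: (t - s) => //= b; rewrite pj ltnW.
Qed.

Lemma two_block_count t (i j : 'I_n) (s : 'I_t) : i < j ->
  count_mem i (two_block (i, j, s)) = s.+1.
Proof.
move=> ij; have ji : (j == i) = false by rewrite -val_eqE gtn_eqF.
by rewrite /= count_cat !count_nseq /= eqxx ji mul1n mul0n addn0.
Qed.

Lemma mem_pair_eq (i j i' j' : 'I_n) : i < j -> i' < j' ->
  [:: i; j] =i [:: i'; j'] -> (i, j) = (i', j').
Proof.
move=> ij ij' e.
have := e i; have := e j; have := e i'; have := e j'; rewrite !inE !eqxx ?orbT /=.
by rewrite -!val_eqE /= => *; congr (_, _); apply: val_inj => /=; lia.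
Qed.

Lemma card_words_on2 t : #|words_on t.+1 2| = 'C(n, 2) * t.
Proof.
pose lt_pairs := [set p : 'I_n * 'I_n | p.1 < p.2].
have card_lt : #|lt_pairs| = 'C(n, 2).
  (* Count by the larger entry: there are [j] indices below [j]. *)
  rewrite -bin2_sum big_mkord -sum1dep_card.
  rewrite -(pair_big_dep xpredT (fun i j : 'I_n => i < j) (fun _ _ => 1)) /=.
  rewrite (exchange_big_dep xpredT) //=; apply: eq_bigr => j _.
  rewrite -(big_ord_widen n (fun=> 1)); last exact: ltnW.
  by rewrite sum1_card card_ord.
have -> : words_on t.+1 2 = [set two_block p | p in setX lt_pairs [set: 'I_t]].
  apply/setP => w; rewrite inE; apply/andP/imsetP => [[bw /undup2P[i [j [ij wij]]]]|].
    have ji : (j == i) = false by rewrite -val_eqE gtn_eqF.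
    have szw : count_mem i w + count_mem j w = t.+1.
      rewrite -[in RHS](size_tuple w) -(count_predC (pred1 i) w); congr (_ + _).
      apply: eq_in_count => k; rewrite wij !inE /= => /orP[]/eqP->.
        by rewrite eqxx eq_sym ji.
      by rewrite eqxx ji.
    have ci : 0 < count_mem i w by rewrite -has_count has_pred1 wij mem_head.
    have cj : 0 < count_mem j w by rewrite -has_count has_pred1 wij !inE eqxx orbT.
    have st : (count_mem i w).-1 < t by lia.
    exists (i, j, Ordinal st); first by rewrite !inE ij.
    (* Both words are sorted, so comparing multiplicities is enough. *)
    apply: (inj_s2m (n := n)) => //; first exact: two_block_sorted.
    apply/mnmP => k; rewrite !mnmE /= count_cat !count_nseq /=.
    have [<-|ik] := eqVneq i k.
      by rewrite ji mul1n mul0n addn0 add1n prednK.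
    have [<-|jk] := eqVneq j k.
      rewrite /= mul0n mul1n !add0n.
      by move: (count_mem i w) (count_mem j w) szw ci => a b; lia.
    by rewrite !mul0n; apply/count_memPn; rewrite wij !inE negb_or !(eq_sym k) ik jk.
  case=> [[[i j] s]] /setXP[] /[!inE] /= ij _ ->.
  split; first by have := two_block_sorted s ij; rewrite inE.
  by apply/undup2P; exists i, j; split=> //; apply: two_block_mem.
rewrite card_in_imset ?cardsX ?card_lt ?cardsT ?card_ord //.
move=> [[i j] s] [[i' j'] s']; rewrite !inE !andbT /= => ij ij' e.
(* The set of letters recovers the ordered pair; the multiplicity of the smaller letter then
   recovers the cut. *)
have ee : (i, j) = (i', j').
  apply: mem_pair_eq => // k.
  by rewrite -(two_block_mem (i, j, s)) e two_block_mem.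
case: ee => ei ej; congr (_, _, _) => //; apply: val_inj => /=.
by apply: succn_inj; rewrite -(two_block_count s ij) e ei two_block_count.
Qed.

Lemma card_basis t : 0 < n -> #|basis n t| = 'C(t + n.-1, t).
Proof.
by case: n => // m _; rewrite -card_sorted_tuples; apply: eq_card => w; rewrite !inE.
Qed.

(* The pairs of constant words are counted twice in the first summand on the right,
   whence [n ^ 2] on the left. *)
Lemma card_word_pairs t :
  #|[set p in setX (basis n t.+1) (basis n t.+1) |
     [|| size (undup p.1) == 1, size (undup p.2) == 1 |
         (size (undup p.1) == 2) && (size (undup p.2) == 2)]]| + n ^ 2 =
  2 * n * #|basis n t.+1| + ('C(n, 2) * t) ^ 2.
Proof.
set B := basis n t.+1; pose W := words_on t.+1.
have inW d w : (w \in W d) = (w \in B) && (size (undup w) == d) by rewrite inE.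
have -> : [set p in setX B B | [|| size (undup p.1) == 1, size (undup p.2) == 1 |
    (size (undup p.1) == 2) && (size (undup p.2) == 2)]] =
    (setX (W 1) B :|: setX B (W 1)) :|: setX (W 2) (W 2).
  apply/setP => -[w v]; rewrite in_setU in_setU !in_setX !inW inE in_setX /=.
  by case: (w \in B); case: (v \in B); rewrite ?andbF ?andbT //= ?orbA.
(* No word has both one and two distinct letters, so the last family is disjoint from the others. *)
rewrite cardsU (_ : _ :&: setX (W 2) (W 2) = set0) ?cards0 ?subn0; last first.
  apply/setP => -[w v]; rewrite in_setI in_setU !in_setX !inW in_set0.
  by case: (size (undup w) =P 1) => [->|_]; case: (size (undup v) =P 1) => [->|_];
    rewrite ?andbF.
have := cardsUI (setX (W 1) B) (setX B (W 1)).
have -> : setX (W 1) B :&: setX B (W 1) = setX (W 1) (W 1).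
  apply/setP => -[w v]; rewrite in_setI !in_setX !inW.
  by case: (w \in B); case: (v \in B); rewrite ?andbF ?andbT.
rewrite !cardsX !card_words_on1 !card_words_on2; lia.
Qed.

End Count.

Lemma card_word_basis (K : fieldType) n t : (2%:R : K) != 0 -> (0 < n)%N -> (n <= t)%N ->
  (#|word_basis K n t.+1| + n ^ 2 = 2 * n * 'C(t + n, n.-1) + ('C(n, 2) * t) ^ 2)%N.
Proof.
move=> K2 n0 nt; have <- : #|basis n t.+1| = 'C(t + n, n.-1).
  (* Symmetry of binomials gives the form that Vandermonde's identity produces. *)
  rewrite card_basis // -[LHS]bin_sub ?leq_addr // addKn; congr 'C(_, _); lia.
rewrite -card_word_pairs; congr (_ + _)%N; apply: eq_card => -[w v].
rewrite !inE; congr (_ && _).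
by rewrite wordprod_xbar_large ?size_tuple.
Qed.

(** * Binomial identities and the Hilbert polynomial *)

Lemma horner_binom_poly t i : (i <= t)%N ->
  (binom_poly ('X - 1) i).[t.+1%:R] = 'C(t, i)%:R.
Proof.
move=> it; rewrite /binom_poly hornerZ horner_prod.
have -> : \prod_(k < i) ('X - 1 - (k%:R)%:P).[t.+1%:R] = (t ^_ i)%:R :> rat.
  rewrite ffact_prod natr_prod; apply: eq_bigr => k _; rewrite !hornerE.
  (* Since [k < i <= t], the natural subtraction [t - k] is not truncated. *)
  by rewrite natrB -?natr1 ?addrK // ltnW // (leq_trans (ltn_ord k)).
rewrite -bin_ffact natrM mulrC mulfK // Num.Theory.pnatr_eq0 -lt0n; exact: fact_gt0.
Qed.

(** The top term is zero; elsewhere ['C(n, i.+1)] is ['C(n, n.-1 - i)], so the lower indices add up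
    to [n.-1] as in Vandermonde's identity. *)
Lemma sum_bin_succ_mul n t : (0 < n)%N ->
  (\sum_(i < n.+1) 'C(n, i.+1) * 'C(t, i) = 'C(t + n, n.-1))%N.
Proof.
case: n => // n _; rewrite big_ord_recr /= [X in (_ + X * _)%N]bin_small // addn0.
rewrite -binomial.Vandermonde; apply: eq_bigr => i _; rewrite mulnC; congr (_ * _)%N.
by rewrite -[LHS]bin_sub ?subSS.
Qed.

(** Turns these binomials into polynomials, within reach of [field]. *)
Lemma bin2_rat m : 'C(m, 2)%:R = m%:R * (m%:R - 1) / 2%:R :> rat.
Proof.
case: m => [|m]; first by rewrite bin0n !mul0r.
have := congr1 (fun k => k%:R : rat) (bin_ffact m.+1 2).
by rewrite ffactnS ffactn1 !natrM -[m.+1%:R]natr1 addrK => <-; field.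
Qed.

(* R[i], for R a model of the real numbers, is the field of complex numbers. *)
Theorem theorem4p6 (R : realType) (n : nat) (hn : (2 <= n)%N) (f : nat -> rat)
  (f0 : f 0%N = (n ^ 2)%N%:R)
  (f1 : f 1%N = 'C(n ^ 2, 2)%:R - ('C(n, 2) ^ 2)%N%:R)
  (f2 : f 2%N = (2 * 'C(n, 2) ^ 2 + 2 * n * 'C(n, 3))%N%:R)
  (fi : forall i : nat, (3 <= i <= n)%N -> f i = (2 * n * 'C(n, i.+1))%N%:R) :
  is_hilbert_poly (@perm2_ideal R[i] n)
    (\sum_(i < n.+1) f i *: binom_poly ('X - 1) i).
Proof.
exists (fun t => #|word_basis R[i] n t|); split; first exact: quot_graded_dim.
(* From degree [n.+1] on, words are longer than [n]. Writing the degree as [t.+1] makes the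
   binomials in degree minus one equal to ['C(t, i)]. *)
exists n.+1 => -[//|t] nt.
have C2 : (2%:R : R[i]) != 0 by rewrite Num.Theory.pnatr_eq0.
have := congr1 (fun k => k%:R : rat) (card_word_basis C2 (ltnW hn) nt).
rewrite !natrD => /(canRL (addrK _)) ->.
rewrite horner_sum.
(* Vandermonde's identity accounts for the part [2 * n * 'C(n, i.+1)] of [f i]; the excess [d i] is
   zero from index 3 on. *)
pose d i : rat := f i - (2 * n * 'C(n, i.+1))%N%:R.
transitivity (\sum_(i < n.+1) ((2 * n)%N%:R * ('C(n, i.+1) * 'C(t, i))%N%:R +
    d i * 'C(t, i)%:R)); last first.
  apply: eq_bigr => i _; rewrite hornerZ horner_binom_poly; last first.
    by rewrite -ltnS (leq_trans (ltn_ord i)).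
  by rewrite /d !natrM; ring.
rewrite big_split /= -mulr_sumr -natr_sum sum_bin_succ_mul ?(ltnW hn) //.
have d0 : d 0%N = - n%:R ^+ 2.
  by rewrite /d f0 bin1 !natrM; ring.
have d1 : d 1%N = 'C(n, 2)%:R ^+ 2.
  by rewrite /d f1 !natrX !natrM !bin2_rat ?natrX; field.
have d2 : d 2%N = 2%:R * 'C(n, 2)%:R ^+ 2.
  by rewrite /d f2 natrD !natrM ?natrX; ring.
have d3 i : (3 <= i <= n)%N -> d i = 0 by move=> /fi; rewrite /d => ->; rewrite subrr.
have -> : \sum_(i < n.+1) d i * 'C(t, i)%:R =
    d 0%N + d 1%N * t%:R + d 2%N * 'C(t, 2)%:R.
  (* As [n] is at least 2, the indices 0, 1 and 2 all occur in the sum. *)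
  move: d3; case: (n) hn => [|[|m]] // _ d3.
  rewrite 3!big_ord_recl big1 ?addr0 /= => [|i _].
    by rewrite bin0 bin1 mulr1 addrA.
  by rewrite d3 ?mul0r // /bump !add1n !ltnS /= ltn_ord.
(* The two-letter pairs match because [t ^ 2 = t + 2 * 'C(t, 2)]; [d 0] is the correction for
   constant pairs. *)
rewrite d0 d1 d2 (bin2_rat t) !natrX !natrM.
by field.
Qed.
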